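(* Let $f:\mathcal S\times\mathcal W\to\mathbb R$ and $\Delta:\mathcal S\times\mathcal W\to\mathbb R^+$. Let $\hat{\mathcal W}$ be an arbitrary set and $g:\mathcal S\times\hat{\mathcal W}\to\mathbb R$ arbitrary. Let $\delta>0$ and $\mathcal F^\delta_{S,W}:=\mathcal G^\delta_{S,W}\cap\mathcal S_{S,W}(f-\Delta)$. Then with probability at least $1-\delta$ over $(S,W)\sim P_{S,W}$, $f(S,W)\le\Delta(S,W)$, provided either of the following holds: (i) for some $\epsilon\in\mathbb R$ and every $\nu_{S,W}\in\mathcal F^\delta_{S,W}$ (with $S$-marginal $\nu_S$ and conditional $\nu_{W|S}$), $$\inf_{p_{\hat W|S}\in\mathcal Q(\nu_{S,W})}\ \inf_{\lambda>0,\,q_{\hat W|S}}\Big\{\mathfrak T_{1,P_S}(\nu_S,p_{\hat W|S},q_{\hat W|S},\lambda g)-D_{KL}(\nu_{S,W}\|P_{W|S}\nu_S)-\lambda\big(\mathbb E_{\nu_{S,W}}[\Delta(S,W)]-\epsilon\big)\Big\}\le\log\delta,$$ where $\mathcal Q(\nu_{S,W})$ is the set of conditionals $p_{\hat W|S}$ with $\mathbb E_{\nu_{S,W}p_{\hat W|S}}[\Delta(S,W)-g(S,\hat W)]\le\epsilon$; (ii) $f>0$, and for some $\alpha>1$ and every $\nu_{S,W}\in\mathcal F^\delta_{S,W}$, $$\inf_{q_{W|S},\ \lambda\ge\alpha/(\alpha-1)}\Big\{\mathfrak T_{\alpha,P_S}(\nu_S,\nu_{W|S},q_{W|S},\lambda\log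 f)-D_{KL}(\nu_{S,W}\|P_{W|S}\nu_S)-\lambda\,\mathbb E_{\nu_S}\big[\log\mathbb E_{\nu_{W|S}}[\Delta(S,W)]\big]\Big\}\le\log\delta.$$
   Context: Setup: $\mathcal Z$ data space, $\mathcal W$ hypothesis space, $S=(Z_1,\dots,Z_n)\sim P_S=\mu^{\otimes n}$ in $\mathcal S=\mathcal Z^n$; a (possibly stochastic) algorithm outputs $W$, inducing $P_{W|S}$ and $P_{S,W}=P_SP_{W|S}$. Natural logarithms. Rényi divergence of order $\alpha\ne1$: $D_\alpha(Q\|P)=\frac1{\alpha-1}\log\mathbb E_Q[(dQ/dP)^{\alpha-1}]$ if $Q\ll P$, else $\infty$; $D_{KL}(Q\|P)=\mathbb E_Q[\log dQ/dP]$ if $Q\ll P$, else $\infty$ ($D_1:=D_{KL}$). For a random variable $X$ with law $P_X$ on $\mathcal X$ and $h:\mathcal X\to\mathbb R$: $\mathcal G^\delta_X=\{\nu_X\text{ distribution on }\mathcal X: D_{KL}(\nu_X\|P_X)\le\log(1/\delta)\}$ and $\mathcal S_X(h)=\{\nu_X: h(x)>0\ \forall x\in\mathrm{supp}(\nu_X)\}$. For $\alpha\ge1$, distributions $P_S,\nu_S$ on $\mathcal S$, conditionals $p_{\hat W|S},q_{\hat W|S}$ on $\hat{\mathcal W}$, and $h:\mathcal S\times\hat{\mathcal W}\to\mathbb R$: $$\mathfrak T_{\alpha,P_S}(\nu_S,p_{\hat W|S},q_{\hat W|S},h)=\mathbb E_{\nu_S}\big[D_\alpha(p_{\hat W|S}\|q_{\hat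 W|S})\big]+\log\mathbb E_{P_Sq_{\hat W|S}}\big[e^{h(S,\hat W)}\big];$$ for $\alpha=1$ the first term is $D_{KL}(p_{\hat W|S}\nu_S\|q_{\hat W|S}\nu_S)$. In (ii), $e^{\lambda\log f}=f^\lambda$. Notation $p_{\hat W|S}\nu_S$ denotes the joint distribution of $(S,\hat W)$ with $S\sim\nu_S$, $\hat W|S\sim p_{\hat W|S}$. *)

(* Defs.v *)
From HB Require Import structures.
From mathcomp Require Import all_boot all_order all_algebra.
From mathcomp Require Import all_classical all_reals all_analysis.
Set Implicit Arguments. Unset Strict Implicit. Unset Printing Implicit Defensive.
Import Order.TTheory GRing.Theory Num.Theory.
Local Open Scope classical_set_scope.
Local Open Scope ring_scope.
Local Open Scope ereal_scope.

Definition jointm {dX dY} {X : measurableType dX} {Y : measurableType dY}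
  {R : realType} (P : set X -> \bar R) (k : X -> set Y -> \bar R)
  : set (X * Y) -> \bar R :=
  fun A => \int[P]_x k x (xsection A x).

(* h is a density (Radon-Nikodym derivative) of Q with respect to P;
   existence of such an h is absolute continuity Q << P (P, Q finite). *)
Definition is_density {d} {T : measurableType d} {R : realType}
  (P Q : set T -> \bar R) (h : T -> R) : Prop :=
  [/\ measurable_fun setT h, (forall x, (0 <= h x)%R) &
      forall A, measurable A -> Q A = \int[P]_(x in A) (h x)%:E].

Definition KL {d} {T : measurableType d} {R : realType}
  (Q P : set T -> \bar R) : \bar R :=
  match pselect (exists h, is_density P Q h) with
  | left e => \int[Q]_x (ln (projT1 (cid e) x))%:E
  | right _ => +oo
  end.

Definition Renyi {d} {T : measurableType d} {R : realType} (alpha : R)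
  (Q P : set T -> \bar R) : \bar R :=
  if alpha == 1%R then KL Q P else
  match pselect (exists h, is_density P Q h) with
  | left e => ((alpha - 1)^-1)%:E *
              lne (\int[Q]_x ((projT1 (cid e) x) `^ (alpha - 1))%:E)
  | right _ => +oo
  end.

(* The functional \mathfrak T_{alpha, P_S}(nu_S, p, q, h).  Sums of extended
   reals use the dual addition (+oo absorbing), so an undefined
   "+oo - +oo" is never counted as small. *)
Definition frakT {dS dY} {S : measurableType dS} {Y : measurableType dY}
  {R : realType} (alpha : R) (PS nuS : set S -> \bar R)
  (p q : S -> set Y -> \bar R) (h : S * Y -> R) : \bar R :=
  dual_adde
    (if alpha == 1%R then KL (jointm nuS p) (jointm nuS q)
     else \int[nuS]_s Renyi alpha (p s) (q s))
    (lne (\int[jointm PS q]_z (expR (h z))%:E)).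

Definition supp_pos {d} {T : measurableType d} {R : realType}
  (nu : set T -> \bar R) (h : T -> R) : Prop :=
  nu [set x | (h x <= 0)%R] = 0.

(* P_S = mu^{(x) n} on S = Z^n (n-tuples): product law on measurable
   rectangles (which determines the product measure). *)
Definition iid_product {dZ} {Z : measurableType dZ} {R : realType} (n : nat)
  (mu : set Z -> \bar R) (PS : set (n.-tuple Z) -> \bar R) : Prop :=
  forall A : 'I_n -> set Z, (forall i, measurable (A i)) ->
    PS [set t | forall i, A i (tnth t i)] = \big[*%E/1]_(i < n) mu (A i).

(* Main.v *)
(* Idea. If f > Delta had probability more than delta, condition the law P of
   (S, W) on an event G contained in {f > Delta}, still of probability
   c > delta, on which f and Delta are bounded, so that all expectations of
   Delta are finite.  The conditional law nu satisfies
   D_KL(nu || P) = - log c, so it belongs to the family F^delta, and the chain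
   rule gives D_KL(nu || P_{W|S} nu_S) = - log c - D_KL(nu_S || P_S).
   In case (i) the Donsker-Varadhan inequality for p nu_S against q P_S bounds
   every term of the infimum from below by log c > log delta.  In case (ii) the
   same inequality, applied on S to log E_q[f^lambda], is combined with a change
   of measure for the Renyi divergence in each fibre.  *)
Require Import Defs.
From HB Require Import structures.
From mathcomp Require Import all_boot all_order all_algebra.
From mathcomp Require Import all_classical all_reals all_analysis.
From mathcomp Require Import measurable_realfun ring lra.
Set Implicit Arguments. Unset Strict Implicit. Unset Printing Implicit Defensive.
Import Order.TTheory GRing.Theory Num.Theory.
Local Open Scope classical_set_scope.
Local Open Scope ring_scope.
Local Open Scope ereal_scope.

(** The lower bound is uniform over the infimum. Write [l] for the divergence of nu_S from P_S and
    [kl] for the one subtracted in the statement, so that [l + kl = - ln c]. The terms in lambda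
    cancel in case (i) and leave a nonnegative remainder in case (ii), and [- l - kl = ln c]
    survives whatever p, q and lambda are. Two obstacles shape the proof. The test functions,
    [lambda * g] or a logarithm of fibre moments, need not be integrable under nu. Renyi divergences
    of fibres need not be measurable in S. Donsker-Varadhan is therefore stated through an
    integrable function [B] lying a.e. above the test function, with the required bound on its mean,
    and all later comparisons are made with [B]. The event keeps [f] between [M^-1] and [M]: the
    upper bound controls Delta and the fibre means of [f], while the lower bound keeps the
    logarithms of these means away from -oo. The threshold [alpha / (alpha - 1)] is the Hölder
    exponent conjugate to alpha. *)

(** * Integration and measurability preliminaries *)

Section integral_le.
Context {d} {T : measurableType d} {R : realType}.

(* Renyi divergences of kernels need not be measurable in the conditioning
   variable, and the integral is a supremum over simple functions. *)
Lemma ge0_le_integral_nonmeas (mu : {measure set T -> \bar R})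
    (f g : T -> \bar R) :
  (forall x, 0 <= f x) -> (forall x, f x <= g x) ->
  \int[mu]_x f x <= \int[mu]_x g x.
Proof.
move=> f0 fg; have g0 x : 0 <= g x := le_trans (f0 x) (fg x).
rewrite !ge0_integralTE//; apply: le_ereal_sup => _ [h hf <-]; exists h => //.
by move=> x; apply: le_trans (hf x) (fg x).
Qed.

(** Positive and negative parts are compared separately, so either integral may be infinite. *)
Lemma ae_le_integral (mu : {measure set T -> \bar R}) (f g : T -> \bar R) :
  measurable_fun setT f -> measurable_fun setT g ->
  {ae mu, forall x, f x <= g x} ->
  \int[mu]_x f x <= \int[mu]_x g x.
Proof.
move=> mf mg fg.
rewrite integralE [leRHS]integralE; apply: leeB.
- apply: ae_ge0_le_integral => //; [exact: measurable_funepos..|].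
  apply: filterS fg => x fgx _; rewrite !funeposE.
  by rewrite ge_max !le_max fgx lexx orbT.
- apply: ae_ge0_le_integral => //; [exact: measurable_funeneg..|].
  apply: filterS fg => x fgx _; rewrite !funenegE.
  by rewrite ge_max !le_max leeN2 fgx lexx orbT.
Qed.

End integral_le.

Lemma measurable_invr_ge0 {d} {T : measurableType d} {R : realType} (f : T -> R) :
  measurable_fun setT f -> (forall x, (0 <= f x)%R) ->
  measurable_fun setT (fun x => (f x)^-1)%R.
Proof.
move=> mf f0; rewrite (_ : (fun _ => _) = (fun y => y `^ (-1))%R \o f).
  by apply: measurableT_comp => //; exact: measurable_powR.
by apply/funext => x /=; rewrite powR_inv1.
Qed.

Lemma ln_le_subr1 {R : realType} (x : R) : (0 < x)%R -> (ln x <= x - 1)%R.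
Proof.
by move=> x0; have := @le_ln1Dx R (x - 1); rewrite subrKC; apply; lra.
Qed.

Lemma ae_prob_ex {d} {T : measurableType d} {R : realType} (P : probability T R)
    (S : T -> Prop) : {ae P, forall x, S x} -> exists x, S x.
Proof.
move=> [N [mN N0 SN]]; apply: contrapT => /forallNP nS.
have NT : N = setT by apply/seteqP; split => // x _; exact/SN/nS.
by move: N0; rewrite NT probability_setT => /eqP; rewrite onee_eq0.
Qed.

Lemma integral_gt0_prob {d} {T : measurableType d} {R : realType}
    (P : probability T R) (f : T -> \bar R) :
  measurable_fun setT f -> (forall x, 0 < f x) -> 0 < \int[P]_x f x.
Proof.
move=> mf f0; rewrite lt_neqAle integral_ge0 ?andbT => [|x _]; last exact: ltW.
apply/eqP => /esym f00.
have : \int[P]_x `|f x| = 0.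
  by rewrite -f00; apply: eq_integral => x _; rewrite gee0_abs// ltW.
move/(ae_eq_integral_abs P measurableT mf) => /ae_prob_ex[x] /(_ I) fx0.
by have := f0 x; rewrite fx0 ltxx.
Qed.

Lemma ae_le_integrable {d} {T : measurableType d} {R : realType}
    (mu : {measure set T -> \bar R}) (f g : T -> \bar R) :
  measurable_fun setT f -> mu.-integrable setT g ->
  {ae mu, forall x, `|f x| <= `|g x|} -> mu.-integrable setT f.
Proof.
move=> mf ig fg; apply/integrableP; split => //.
have /integrableP[mg goo] := ig; apply: le_lt_trans goo.
apply: ae_ge0_le_integral => //; try exact: measurableT_comp.
by apply: filterS fg => x + _.
Qed.

Lemma measurable_lne {R : realType} : measurable_fun setT (@lne R).
Proof.
rewrite (_ : @lne R = (fun x => if x <= 0 then -oo else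
    if x == +oo then +oo else (ln (fine x))%:E)); last first.
  by apply/funext => -[r| |]/=; rewrite ?lee_fin ?leye_eq ?leNye.
apply: measurable_fun_ifT => //; first exact: measurable_fun_lee.
apply: measurable_fun_ifT => //; first exact: measurable_fun_eqe.
by apply/measurable_EFinP; apply: measurableT_comp => //; exact: measurable_fine.
Qed.

Lemma measurable_bool_set {d} {T : measurableType d} (b : T -> bool) :
  measurable_fun setT b -> measurable [set x | b x].
Proof.
by move=> mb; rewrite -[X in measurable X]setTI; exact: (mb measurableT [set true]).
Qed.

(** * Transport of integrals along measure-preserving maps *)

Section measure_preserving.
Context {d1 d2} {T1 : measurableType d1} {T2 : measurableType d2} {R : realType}.
Variables (mu1 : {measure set T1 -> \bar R}) (mu2 : {measure set T2 -> \bar R}).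
Variable phi : T1 -> T2.
Hypothesis mphi : measurable_fun setT phi.
Hypothesis phiE : forall A, measurable A -> mu2 A = mu1 (phi @^-1` A).

Lemma ge0_integral_mpres (f : T2 -> \bar R) : measurable_fun setT f ->
  (forall x, 0 <= f x) -> \int[mu2]_x f x = \int[mu1]_x f (phi x).
Proof.
move=> mf f0; rewrite (eq_measure_integral (pushforward mu1 phi)) => [|A mA _].
  by rewrite ge0_integral_pushforward// preimage_setT.
exact: phiE.
Qed.

Lemma integral_mpres (f : T2 -> \bar R) : measurable_fun setT f ->
  \int[mu2]_x f x = \int[mu1]_x f (phi x).
Proof.
move=> mf; rewrite integralE [RHS]integralE !ge0_integral_mpres//.
- by congr (_ - _); apply: eq_integral => x _; rewrite ?funeposE ?funenegE.
- exact: measurable_funeneg.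
- exact: measurable_funepos.
Qed.

Lemma integrable_mpres (f : T2 -> \bar R) : mu2.-integrable setT f ->
  mu1.-integrable setT (f \o phi).
Proof.
move=> intf; have mf := measurable_int _ intf.
apply/integrableP; split; first exact: measurableT_comp.
move/integrableP : intf => [_]; rewrite ge0_integral_mpres//.
exact: measurableT_comp.
Qed.

Lemma ae_mpres (Q : T2 -> Prop) :
  {ae mu2, forall x, Q x} -> {ae mu1, forall x, Q (phi x)}.
Proof.
move=> [N [mN N0 QN]]; exists (phi @^-1` N); split.
- by rewrite -[X in measurable X]setTI; exact: mphi.
- by rewrite -phiE.
- by move=> x /= Qx; exact: QN.
Qed.

End measure_preserving.

(** * Densities and the Donsker-Varadhan inequality *)

Section density.
Context {d} {T : measurableType d} {R : realType}.
Variables (P Q : probability T R).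

Lemma density_integral_eq1 (h : T -> R) : is_density P Q h ->
  \int[P]_x (h x)%:E = 1.
Proof. by move=> [_ _ <-//]; exact: probability_setT. Qed.

Lemma density_integrable (h : T -> R) : is_density P Q h ->
  P.-integrable setT (EFin \o h).
Proof.
move=> hh; have [mh h0 _] := hh; apply/integrableP; split.
  exact/measurable_EFinP.
rewrite (eq_integral (EFin \o h)) ?density_integral_eq1 ?ltry//.
by move=> x _ /=; rewrite ger0_norm.
Qed.

Lemma density_dominates (h : T -> R) (A : set T) : is_density P Q h ->
  measurable A -> P A = 0 -> Q A = 0.
Proof.
move=> [mh h0 Qh] mA PA; rewrite Qh// (eq_integral (abse \o EFin \o h)).
  by apply: integral_abs_eq0 => //; exact/measurable_funTS/measurable_EFinP.
by move=> x _ /=; rewrite ger0_norm.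
Qed.

Lemma density_ae (h : T -> R) (S : T -> Prop) : is_density P Q h ->
  {ae P, forall x, S x} -> {ae Q, forall x, S x}.
Proof.
move=> hh [N [mN N0 SN]]; exists N; split => //.
exact: density_dominates hh mN N0.
Qed.

Lemma density_gt0 (h : T -> R) : is_density P Q h ->
  {ae Q, forall x, (0 < h x)%R}.
Proof.
move=> [mh h0 hh]; exists (h @^-1` [set 0%R]); split.
- by rewrite -[X in measurable X]setTI; exact: mh.
- rewrite hh; last by rewrite -[X in measurable X]setTI; exact: mh.
  by apply: integral0_eq => x /= ->.
- by move=> x /=; have := h0 x; rewrite le_eqVlt => /orP[/eqP <-//|].
Qed.

Lemma density_uniq (h1 h2 : T -> R) : is_density P Q h1 -> is_density P Q h2 ->
  {ae P, forall x, h1 x = h2 x}.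
Proof.
move=> h1P h2P; have [m1 _ Q1] := h1P; have [m2 _ Q2] := h2P.
have : ae_eq P setT (EFin \o h1) (EFin \o h2).
  apply: integral_ae_eq => //.
  - exact: density_integrable.
  - exact/measurable_EFinP.
  - by move=> A _ mA; rewrite -Q1// -Q2.
by apply: filterS => x /(_ I) [].
Qed.

(** The Radon-Nikodym derivative [g] has the same integrals over measurable sets as [h], hence
    equals [h] P-a.e., and its change of variables carries over to [h]. *)
Lemma ge0_integral_density (h : T -> R) (f : T -> \bar R) : is_density P Q h ->
  measurable_fun setT f -> (forall x, 0 <= f x) ->
  \int[Q]_x f x = \int[P]_x (f x * (h x)%:E).
Proof.
move=> hh mf f0; have [mh h0 Qh] := hh.
have QP : Q `<< P.
  by apply/null_content_dominatesP => A mA PA; exact: density_dominates hh mA PA.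
rewrite -(Radon_Nikodym_SigmaFinite.change_of_variables QP)//.
set g := Radon_Nikodym_SigmaFinite.f _ _.
have ig : P.-integrable setT g by exact: Radon_Nikodym_SigmaFinite.f_integrable.
have : ae_eq P setT g (EFin \o h).
  apply: integral_ae_eq => //; first exact/measurable_EFinP.
  by move=> A _ mA; rewrite -Qh// (Radon_Nikodym_SigmaFinite.f_integral QP).
move=> gh; apply: ge0_ae_eq_integral => //.
- by apply: emeasurable_funM => //; exact: measurable_int ig.
- by apply: emeasurable_funM => //; exact/measurable_EFinP.
- by move=> x _; rewrite mule_ge0// Radon_Nikodym_SigmaFinite.f_ge0.
- by move=> x _; rewrite mule_ge0// lee_fin.
- by apply: filterS gh => x /(_ I) ->.
Qed.

(** [KL] picks a density by choice. Two densities agree P-a.e., hence Q-a.e., so any of them gives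
    the same value. *)
Lemma KL_density (h : T -> R) : is_density P Q h ->
  KL Q P = \int[Q]_x (ln (h x))%:E.
Proof.
move=> hh; rewrite /KL; case: pselect => [e|]; last by move=> []; exists h.
case: cid => /= k kk; have [mh _ _] := hh; have [mk _ _] := kk.
apply: ae_eq_integral => //; try exact/measurable_EFinP/measurableT_comp.
by apply: (density_ae hh); apply: filterS (density_uniq kk hh) => x -> _.
Qed.

(** The negative part of [ln h] always has finite Q-mean: under P it becomes [h * max(- ln h, 0)],
    which is at most 1 because [ln (1/h) <= 1/h]. Only the positive part can make [KL] infinite. *)
Lemma KL_integrable : KL Q P != +oo ->
  exists h, is_density P Q h /\ Q.-integrable setT (fun x => (ln (h x))%:E).
Proof.
move=> KLoo.
have [[h hh]|] := pselect (exists h, is_density P Q h); last first.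
  by move=> nh; move: KLoo; rewrite /KL; case: pselect.
exists h; split => //; have [mh h0 _] := hh.
have mln : measurable_fun setT (fun x => (ln (h x))%:E).
  exact/measurable_EFinP/measurableT_comp.
have negoo : \int[Q]_x (fun x => (ln (h x))%:E)^\- x < +oo.
  rewrite (ge0_integral_density hh)//; last exact: measurable_funeneg.
  apply: (@le_lt_trans _ _ (\int[P]_x 1)); last first.
    by rewrite integral_cst//= mul1e probability_setT ltry.
  apply: ge0_le_integral => //.
  - by move=> x _; rewrite mule_ge0// lee_fin.
  - by apply: emeasurable_funM; [exact: measurable_funeneg|exact/measurable_EFinP].
  - move=> x _; rewrite funenegE -EFinN -EFin_max -EFinM lee_fin.
    have := h0 x; rewrite le_eqVlt => /orP[/eqP <-|hx]; first by rewrite mulr0.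
    rewrite -ler_pdivlMr// mul1r ge_max invr_ge0 (ltW hx) andbT -lnV ?posrE//.
    by apply/ltW/ln_sublinear; rewrite invr_gt0.
apply/integrableP; split => //.
rewrite (eq_integral (fun x => ((fun x => (ln (h x))%:E)^\+ x +
   (fun x => (ln (h x))%:E)^\- x))); last first.
  by move=> x _; have /(congr1 (@^~ x)) := fune_abse (fun x => (ln (h x))%:E).
rewrite ge0_integralD//; [|exact: measurable_funepos|exact: measurable_funeneg].
apply: lte_add_pinfty => //; rewrite ltNge leye_eq; apply: contra KLoo => /eqP e.
by rewrite (KL_density hh) integralE e addye// eqe_oppLR lt_eqF.
Qed.

(** [F] is the ratio of the Gibbs density [expR phi / C] to [u]. Since [phi = ln F + ln C + ln u]
    wherever [u > 0], the bound [ln F <= F - 1] gives the majorant [B], and [F] has Q-mean at most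
    1. The majorant stands in for the Q-mean of [phi], which may fail to exist. *)
Lemma donsker_varadhan (u phi : T -> R) (C : R) : is_density P Q u ->
  Q.-integrable setT (fun x => (ln (u x))%:E) ->
  measurable_fun setT phi -> \int[P]_x (expR (phi x))%:E = C%:E ->
  exists B : T -> R, [/\ Q.-integrable setT (EFin \o B),
    \int[Q]_x (B x)%:E <= (ln C)%:E + \int[Q]_x (ln (u x))%:E &
    {ae Q, forall x, (phi x <= B x)%R}].
Proof.
move=> uu iu mphi phiC; have [mu u0 _] := uu.
have C0 : (0 < C)%R.
  rewrite -lte_fin -phiC; apply: integral_gt0_prob => [|x].
    exact/measurable_EFinP/measurableT_comp.
  by rewrite lte_fin expR_gt0.
pose F x : R := (expR (phi x) / (C * u x))%R.
have mF : measurable_fun setT F.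
  apply: measurable_funM; first exact: measurableT_comp.
  apply: measurable_invr_ge0; first exact: measurable_funM.
  by move=> x; rewrite mulr_ge0// ltW.
have F0 x : (0 <= F x)%R.
  by rewrite divr_ge0 ?expR_ge0// mulr_ge0// ltW.
(* Equality can fail: where [u] vanishes, division by zero makes [F] zero and the mass of
   [expR phi / C] there is lost. *)
have F1 : \int[Q]_x (F x)%:E <= 1.
  rewrite (ge0_integral_density uu)//; last exact/measurable_EFinP.
  apply: (@le_trans _ _ (\int[P]_x ((C^-1)%:E * (expR (phi x))%:E))).
    apply: ge0_le_integral => //.
    - by move=> x _; rewrite mule_ge0// lee_fin.
    - by apply: emeasurable_funM; apply/measurable_EFinP.
    - by apply: emeasurable_funM => //; apply/measurable_EFinP/measurableT_comp.
    - move=> x _; rewrite -!EFinM lee_fin /F.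
      have := u0 x; rewrite le_eqVlt => /orP[/eqP <-|ux].
        by rewrite !mulr0 mulr_ge0 ?expR_ge0// invr_ge0 ltW.
      by rewrite le_eqVlt; apply/orP; left; apply/eqP; field; rewrite !gt_eqF.
  rewrite ge0_integralZl//; last 2 first.
  - exact/measurable_EFinP/measurableT_comp.
  - by rewrite lee_fin invr_ge0 ltW.
  by rewrite phiC -EFinM mulVf// gt_eqF.
have iF : Q.-integrable setT (EFin \o F).
  apply/integrableP; split; first exact/measurable_EFinP.
  rewrite (eq_integral (EFin \o F)) => [|x _ /=]; last by rewrite ger0_norm.
  by rewrite (le_lt_trans F1)// ltry.
have ic (r : R) : Q.-integrable setT (cst r%:E).
  exact: finite_measure_integrable_cst.
exists (fun x => F x + (ln C - 1) + ln (u x))%R; split.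
- apply: (@eq_integrable _ _ _ _ _ _
      (((EFin \o F) \+ cst (ln C - 1)%:E) \+ (fun x => (ln (u x))%:E))) => //.
  by apply: integrableD => //; apply: integrableD.
- rewrite (eq_integral (((EFin \o F) \+ cst (ln C - 1)%:E) \+
    (fun x => (ln (u x))%:E)))//.
  rewrite integralD//; last by apply: integrableD.
  rewrite integralD// integral_cst//= probability_setT mule1.
  rewrite leeD2r// (le_trans (leeD2r _ F1))//.
  by rewrite -EFinD lee_fin; lra.
- apply: filterS (density_gt0 uu) => x ux.
  have Fx : (0 < F x)%R by rewrite /F divr_gt0 ?expR_gt0 ?mulr_gt0.
  have : (phi x = ln (F x) + ln C + ln (u x))%R.
    rewrite -!lnM ?posrE//; last by rewrite mulr_gt0.
    by rewrite /F -mulrA divfK ?mulf_neq0 ?gt_eqF// expRK.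
  by move=> ->; have := ln_le_subr1 Fx; lra.
Qed.

End density.

(** * Joint law of a marginal and a kernel *)

Section joint_probability.
Context {dX dY} {X : measurableType dX} {Y : measurableType dY} {R : realType}.
Variables (P : probability X R) (k : R.-pker X ~> Y).

(** Convertible with [jointm], but taking a genuine probability and a probability kernel, so that a
    canonical probability structure can be attached to it. *)
Definition joint_prob : set (X * Y) -> \bar R := jointm P (fun x => k x).

Lemma measurable_kernel_xsection A : measurable A ->
  measurable_fun setT (fun x => k x (xsection A x)).
Proof.
by move=> mA; apply: measurable_fun_xsection_finite_kernel; rewrite inE.
Qed.

Let joint_prob0 : joint_prob set0 = 0.
Proof.
rewrite /joint_prob /jointm integral0_eq// => x _.
by rewrite xsection0 measure0.
Qed.

Let joint_prob_ge0 A : 0 <= joint_prob A.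
Proof. exact: integral_ge0. Qed.

Let joint_prob_sigma_additive : semi_sigma_additive joint_prob.
Proof.
move=> F mF tF mUF; rewrite [X in _ --> X](_ : _ =
  \int[P]_x (\sum_(n <oo) k x (xsection (F n) x))); last first.
  apply: eq_integral => x _; rewrite xsection_bigcup.
  apply/esym/cvg_lim => //; apply: measure_semi_sigma_additive.
  - by move=> n; exact: measurable_xsection.
  - exact: trivIset_xsection.
  - by apply: bigcupT_measurable => n; exact: measurable_xsection.
apply/cvg_closeP; split.
  by apply: is_cvg_nneseries => n _ _; exact: integral_ge0.
rewrite closeE// integral_nneseries// => n.
exact: measurable_kernel_xsection.
Qed.

HB.instance Definition _ := isMeasure.Build _ _ _ joint_prob
  joint_prob0 joint_prob_ge0 joint_prob_sigma_additive.

Let joint_prob_setT : joint_prob setT = 1.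
Proof.
rewrite /joint_prob /jointm (eq_integral (cst 1)).
  by rewrite integral_cst//= probability_setT mule1.
move=> x _.
rewrite (_ : xsection setT x = setT) ?prob_kernel//.
by apply/seteqP; split => // y _; rewrite /xsection/= inE.
Qed.

HB.instance Definition _ := Measure_isProbability.Build _ _ _
  joint_prob joint_prob_setT.

End joint_probability.

Section pair_kernel.
Context {dX dY} {X : measurableType dX} {Y : measurableType dY} {R : realType}.
Variable k : R.-pker X ~> Y.

(** Pushes [k x] forward along [y |-> (x, y)]. Composed with the constant kernel [P] on [unit], it
    yields [joint_prob P k], and integration against a composition of kernels then gives the
    iterated integral. *)
Definition pair_kernel : unit * X -> {measure set (X * Y) -> \bar R} :=
  fun ux => measure_function_pushforward__canonical__measure_function_Measure
    (k ux.2) (pair1_measurable ux.2).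

Let measurable_pair_kernel U : measurable U ->
  measurable_fun setT (pair_kernel ^~ U).
Proof.
move=> mU.
rewrite (_ : pair_kernel ^~ U = (fun x => k x (xsection U x)) \o snd).
  by apply: measurableT_comp => //; exact: measurable_kernel_xsection.
apply/funext => -[u x]/=; rewrite /pushforward; congr (k x _).
by apply/seteqP; split => y; rewrite /xsection/= inE.
Qed.

HB.instance Definition _ := isKernel.Build _ _ _ _ _
  pair_kernel measurable_pair_kernel.

Let pair_kernel_prob x : pair_kernel x setT = 1.
Proof. by rewrite /pair_kernel/= /pushforward preimage_setT prob_kernel. Qed.

HB.instance Definition _ := Kernel_isProbability.Build _ _ _ _ _
  pair_kernel pair_kernel_prob.

End pair_kernel.

Section joint_integral.
Context {dX dY} {X : measurableType dX} {Y : measurableType dY} {R : realType}.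
Variables (P : probability X R) (k : R.-pker X ~> Y).

Lemma ge0_integral_joint (f : X * Y -> \bar R) : measurable_fun setT f ->
  (forall z, 0 <= f z) ->
  \int[joint_prob P k]_z f z = \int[P]_x \int[k x]_y f (x, y).
Proof.
move=> mf f0.
pose l : R.-pker unit ~> X :=
  kprobability (measurable_cst (P : pprobability X R) : measurable_fun setT _).
transitivity (\int[kcomp l (pair_kernel k) tt]_z f z).
  apply: eq_measure_integral => A mA _; rewrite /kcomp/=.
  apply: eq_integral => x _; rewrite /pushforward; congr (k x _).
  by apply/seteqP; split => y; rewrite /xsection/= inE.
rewrite integral_kcomp//; apply: eq_integral => x _.
rewrite ge0_integral_pushforward ?preimage_setT//.
Qed.

Lemma joint_prob_fst A : measurable A -> joint_prob P k (fst @^-1` A) = P A.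
Proof.
move=> mA; transitivity (\int[P]_x (\1_A x)%:E); last first.
  by rewrite integral_indic// setIT.
apply: eq_integral => x _; rewrite indicE; have [xA|xA] := boolP (x \in A).
  rewrite (_ : xsection _ x = setT) ?prob_kernel//.
  by apply/seteqP; split => // y _; rewrite /xsection/= inE /=; exact/set_mem.
rewrite (_ : xsection _ x = set0) ?measure0//.
apply/seteqP; split => // y; rewrite /xsection/= inE /= => /mem_set.
by rewrite (negbTE xA).
Qed.

Lemma integral_joint_fst (f : X -> \bar R) : measurable_fun setT f ->
  \int[joint_prob P k]_z f z.1 = \int[P]_x f x.
Proof.
move=> mf; rewrite [RHS](integral_mpres (mu1 := joint_prob P k) (phi := fst))//.
by move=> A mA; exact/esym/joint_prob_fst.
Qed.

(** This bridges the two reference measures of the functional: the divergence term compares with q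
    nu_S, the exponential moment is taken under q P_S. *)
Lemma joint_density_fst (Q : probability X R) (r : X -> R) :
  is_density P Q r -> is_density (joint_prob P k) (joint_prob Q k) (r \o fst).
Proof.
move=> hr; have [mr r0 _] := hr; split => //.
- exact: measurableT_comp.
- by move=> z; exact: r0.
- move=> A mA; rewrite integral_mkcond ge0_integral_joint; last 2 first.
  + apply/(measurable_restrictT _ mA)/measurable_funTS/measurable_EFinP.
    exact: measurableT_comp.
  + by move=> z; rewrite patchE; case: ifP => // _; rewrite lee_fin; exact: r0.
  rewrite /joint_prob /jointm (ge0_integral_density hr)//; last first.
    exact: measurable_kernel_xsection.
  apply: eq_integral => x _; rewrite muleC.
  have mAx : measurable (xsection A x) by exact: measurable_xsection.
  rewrite -[X in k x X]setIT -integral_indic// -ge0_integralZl//; last 2 first.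
  + exact/measurable_EFinP.
  + by rewrite lee_fin.
  apply: eq_integral => y _; rewrite patchE indicE mem_xsection.
  by case: ifP => _; rewrite ?mule1 ?mule0.
Qed.

End joint_integral.

Lemma density_trans {d} {T : measurableType d} {R : realType}
    (P Q S : probability T R) (u v : T -> R) :
  is_density P Q u -> is_density Q S v -> is_density P S (fun x => v x * u x)%R.
Proof.
move=> hu [mv v0 hv]; have [mu u0 _] := hu; split.
- exact: measurable_funM.
- by move=> x; rewrite mulr_ge0.
- move=> A mA; rewrite hv// integral_mkcond (ge0_integral_density hu); last 2 first.
  + exact/(measurable_restrictT _ mA)/measurable_funTS/measurable_EFinP.
  + by move=> x; rewrite patchE; case: ifP => // _; rewrite lee_fin.
  rewrite [RHS]integral_mkcond; apply: eq_integral => x _; rewrite !patchE.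
  by case: ifP => // _; rewrite mul0e.
Qed.

Section kernel_fst.
Context {dX dY dZ} {X : measurableType dX} {Y : measurableType dY}
  {Z : measurableType dZ} {R : realType}.
Variable p : R.-pker X ~> Z.

(** Drawing from [p x.1] makes the new variable conditionally independent of the Y-coordinate given
    X. This is the coupling of W and its surrogate under which the constraint on [Delta - g] is
    stated. *)
Definition kernel_fst : X * Y -> {measure set Z -> \bar R} := fun x => p x.1.

Let measurable_kernel_fst U : measurable U ->
  measurable_fun setT (kernel_fst ^~ U).
Proof.
move=> mU; apply: (measurableT_comp (f := p ^~ U)) => //.
exact: measurable_kernel.
Qed.

HB.instance Definition _ := isKernel.Build _ _ _ _ _ kernel_fst measurable_kernel_fst.

Let kernel_fst_prob x : kernel_fst x setT = 1.
Proof. exact: prob_kernel. Qed.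

HB.instance Definition _ := Kernel_isProbability.Build _ _ _ _ _
  kernel_fst kernel_fst_prob.

Lemma joint_prob_marginal (P : probability X R) (k : R.-pker X ~> Y) A :
  measurable A -> joint_prob P p A =
  joint_prob (joint_prob P k) kernel_fst ((fun y => (y.1.1, y.2)) @^-1` A).
Proof.
move=> mA.
rewrite /joint_prob /jointm -/(joint_prob P k).
rewrite -(integral_joint_fst P k); last exact: measurable_kernel_xsection.
apply: eq_integral => z _; rewrite /kernel_fst; congr (p z.1 _).
Qed.

End kernel_fst.

(** * Change of measure for the Renyi divergence *)

(* With x = f / m, G1 = h^(alpha-1) / a and G2 = f^lam / (B h), this is
   ln t <= t - 1 applied to G1 / x, G2 / x and 1 / x; integrating over p, for which
   x and G1 have mean 1 and G2 has mean at most 1, leaves 0 <= K. *)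
Lemma Renyi_pointwise {R : realType} (alpha lam a B m h f K : R) :
  (1 < alpha)%R -> (alpha / (alpha - 1) <= lam)%R -> (0 < a)%R -> (0 < B)%R ->
  (0 < m)%R -> (0 < h)%R -> (0 < f)%R ->
  K = ((alpha - 1)^-1 * ln a + ln B - lam * ln m)%R ->
  (0 <= (K - lam) / m * f + (lam - 1 - (alpha - 1)^-1)
       + (alpha - 1)^-1 / a * h `^ (alpha - 1) + expR (lam * ln f) / (B * h))%R.
Proof.
move=> a1 al a0 B0 m0 h0 f0 KE; pose beta := ((alpha - 1)^-1)%R.
have beta0 : (0 < beta)%R by rewrite invr_gt0; lra.
have abeta : ((alpha - 1) * beta = 1)%R by rewrite mulfV// gt_eqF//; lra.
(* As [1 + beta = alpha / (alpha - 1)], the threshold on [lam] says exactly that the inequality for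
   [1 / x] gets a nonnegative weight. *)
have {}al : (0 <= lam - 1 - beta)%R.
  by rewrite -/beta in al; lra.
pose x := (f / m)%R; have x0 : (0 < x)%R by rewrite divr_gt0.
pose G1 := (h `^ (alpha - 1) / a)%R.
have G10 : (0 < G1)%R by rewrite divr_gt0 ?powR_gt0.
pose G2 := (expR (lam * ln f) / (B * h))%R.
have G20 : (0 < G2)%R by rewrite divr_gt0 ?mulr_gt0 ?expR_gt0.
have lx : ln x = (ln f - ln m)%R by rewrite ln_div.
have l1 : (ln (G1 / x) = (alpha - 1) * ln h - ln a - ln x)%R.
  by rewrite ln_div// ln_div ?posrE ?powR_gt0// ln_powR.
have l2 : (ln (G2 / x) = lam * ln f - ln B - ln h - ln x)%R.
  by rewrite ln_div// ln_div ?posrE ?expR_gt0 ?mulr_gt0// expRK lnM// opprD addrA.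
have i1 : (ln (G1 / x) <= G1 / x - 1)%R by rewrite ln_le_subr1// divr_gt0.
have i2 : (ln (G2 / x) <= G2 / x - 1)%R by rewrite ln_le_subr1// divr_gt0.
have i3 : (ln x^-1 <= x^-1 - 1)%R by rewrite ln_le_subr1// invr_gt0.
rewrite lnV// in i3.
have i1' : (beta * x * ln (G1 / x) <= beta * (G1 - x))%R.
  rewrite -mulrA (ler_wpM2l (ltW beta0))//.
  apply: le_trans (ler_wpM2l (ltW x0) i1) _.
  by rewrite mulrBr mulrCA divff ?gt_eqF// !mulr1.
have i2' : (x * ln (G2 / x) <= G2 - x)%R.
  apply: le_trans (ler_wpM2l (ltW x0) i2) _.
  by rewrite mulrBr mulrCA divff ?gt_eqF// !mulr1.
have i3' : (x - 1 <= x * ln x)%R.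
  rewrite lerNl in i3; apply: le_trans (ler_wpM2l (ltW x0) i3).
  by rewrite opprB mulrBr divff ?gt_eqF// mulr1.
have i3'' := ler_wpM2l al i3'.
rewrite l1 in i1'; rewrite l2 in i2'.
rewrite -/beta -/G2.
rewrite (_ : (K - lam) / m * f = (K - lam) * x)%R; last by rewrite /x; ring.
rewrite (_ : beta / a * h `^ (alpha - 1) = beta * G1)%R; last by rewrite /G1; ring.
(* The weight [beta] gives [ln h] coefficient 1 here, so it cancels against the [- ln h] coming from
   [G2]. The goal is then the sum of [i1'], [i2'] and [i3'']. *)
have e1 : (beta * x * ((alpha - 1) * ln h - ln a - ln x) =
   x * ln h - beta * x * ln a - beta * x * ln x)%R.
  rewrite !mulrBr; congr (_ - _ - _)%R.
  by rewrite mulrA -(mulrC (alpha - 1)%R) !mulrA abeta mul1r.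
rewrite e1 in i1'.
have -> : K = (beta * ln a + ln B - lam * (ln f - ln x))%R.
  by rewrite KE lx -/beta; ring.
move: i1' i2' i3''; set u := ln h; set v := ln a; set w := ln B.
set y := ln f; set z := ln x.
nra.
Qed.

(** At [lam = alpha / (alpha - 1)] this is the logarithm of Hölder's inequality for the q-mean of
    [h * f], with [h] the density of p. A larger [lam] corresponds to a smaller conjugate order, and
    Renyi divergences increase with the order. The pointwise inequality treats all these [lam] at
    once. *)
Lemma Renyi_change_of_measure {d} {T : measurableType d} {R : realType}
    (p q : probability T R) (alpha lam M m B : R) (f : T -> R) :
  (1 < alpha)%R -> (alpha / (alpha - 1) <= lam)%R ->
  measurable_fun setT f -> (forall x, (0 < f x <= M)%R) ->
  \int[p]_x (f x)%:E = m%:E -> \int[q]_x (expR (lam * ln (f x)))%:E = B%:E ->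
  (lam * ln m)%:E <= Renyi alpha p q + (ln B)%:E.
Proof.
move=> a1 al mf fM pf qf.
have f0 x : (0 < f x)%R by have /andP[] := fM x.
have m0 : (0 < m)%R.
  rewrite -lte_fin -pf; apply: integral_gt0_prob => [|x]; last by rewrite lte_fin.
  exact/measurable_EFinP.
have mfl : measurable_fun setT (fun x => expR (lam * ln (f x))).
  apply: measurableT_comp => //; apply: measurable_funM => //.
  exact: measurableT_comp.
have B0 : (0 < B)%R.
  rewrite -lte_fin -qf; apply: integral_gt0_prob => [|x].
    exact/measurable_EFinP.
  by rewrite lte_fin expR_gt0.
rewrite /Renyi gt_eqF//; case: pselect => [e|_]; last by rewrite addye// leey.
case: cid => /= h hh {e}; have [mh h0 _] := hh.
have beta0 : (0 < (alpha - 1)^-1)%R by rewrite invr_gt0; lra.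
have mpow : measurable_fun setT (fun x => h x `^ (alpha - 1))%R.
  exact: (measurableT_comp (measurable_powR _)).
set A := \int[p]_x _.
have A0 : 0 < A.
  rewrite lt_neqAle integral_ge0 ?andbT => [|x _]; last by rewrite lee_fin powR_ge0.
  apply/eqP => /esym A0.
  have : \int[p]_x `|(h x `^ (alpha - 1))%:E| = 0.
    by rewrite -A0; apply: eq_integral => x _; rewrite gee0_abs// lee_fin powR_ge0.
  move/(ae_eq_integral_abs p measurableT (proj2 (measurable_EFinP _ _) mpow)) => Z.
  have : {ae p, forall x, (0 < h x)%R /\ (h x `^ (alpha - 1) = 0)%R}.
    by apply: filterS2 (density_gt0 hh) Z => x hx /(_ I) [].
  by move=> /ae_prob_ex[x [hx /eqP]]; rewrite gt_eqF// powR_gt0.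
have [Aoo|] := eqVneq A +oo.
  by rewrite Aoo/= gt0_muley ?lte_fin// addye// leey.
rewrite -ltey => Aoo.
have Afin : A \is a fin_num by rewrite ge0_fin_numE// ltW.
have [a Aa] : exists a, A = a%:E by exists (fine A); rewrite fineK.
have a0 : (0 < a)%R by rewrite -lte_fin -Aa.
rewrite Aa lne_EFin// -EFinM -EFinD lee_fin -subr_ge0.
set K := (_ - _)%R; have KE : K = ((alpha - 1)^-1 * ln a + ln B - lam * ln m)%R by [].
have c0 x : (0 <= expR (lam * ln (f x)) / (B * h x))%R.
  by rewrite divr_ge0 ?expR_ge0// mulr_ge0// ltW.
have mG2 : measurable_fun setT (fun x => expR (lam * ln (f x)) / (B * h x))%R.
  apply: measurable_funM => //; apply: measurable_invr_ge0.
    exact: measurable_funM.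
  by move=> x; rewrite mulr_ge0// ltW.
have G2le : \int[p]_x (expR (lam * ln (f x)) / (B * h x))%:E <= 1.
  rewrite (ge0_integral_density hh)//; last exact/measurable_EFinP.
  apply: (@le_trans _ _ (\int[q]_x ((B^-1)%:E * (expR (lam * ln (f x)))%:E))).
    apply: ge0_le_integral => //.
    - by move=> x _; rewrite mule_ge0// lee_fin.
    - by apply: emeasurable_funM; apply/measurable_EFinP.
    - by apply: emeasurable_funM => //; apply/measurable_EFinP.
    - move=> x _; rewrite -!EFinM lee_fin.
      have := h0 x; rewrite le_eqVlt => /orP[/eqP <-|hx].
        by rewrite !mulr0 mulr_ge0 ?expR_ge0// invr_ge0 ltW.
      by rewrite le_eqVlt; apply/orP; left; apply/eqP; field; rewrite !gt_eqF.
  rewrite ge0_integralZl//; last 2 first.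
  - exact/measurable_EFinP.
  - by rewrite lee_fin invr_ge0 ltW.
  by rewrite qf -EFinM mulVf// gt_eqF.
have iG2 : p.-integrable setT (fun x => (expR (lam * ln (f x)) / (B * h x))%:E).
  apply/integrableP; split; first exact/measurable_EFinP.
  under eq_integral do rewrite gee0_abs ?lee_fin//.
  by rewrite (le_lt_trans G2le)// ltry.
have iG1 : p.-integrable setT (fun x => (h x `^ (alpha - 1))%:E).
  apply/integrableP; split; first exact/measurable_EFinP.
  by under eq_integral do rewrite gee0_abs ?lee_fin ?powR_ge0//.
have if_ : p.-integrable setT (EFin \o f).
  apply/integrableP; split; first exact/measurable_EFinP.
  rewrite (eq_integral (EFin \o f)) => [|x _ /=]; last by rewrite ger0_norm// ltW.
  by rewrite pf ltry.
have ic (r : R) : p.-integrable setT (cst r%:E).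
  exact: finite_measure_integrable_cst.
(* The four terms integrate to [K - lam], [lam - 1 - beta], [beta] and at most 1, with
   [beta = (alpha - 1)^-1]; their sum is at most [K]. *)
have : 0 <= \int[p]_x ((((K - lam) / m)%:E * (EFin \o f) x
   + (lam - 1 - (alpha - 1)^-1)%:E)
   + ((alpha - 1)^-1 / a)%:E * (h x `^ (alpha - 1))%:E
   + (expR (lam * ln (f x)) / (B * h x))%:E).
  rewrite -(integral0 p setT); apply: ae_le_integral.
  - exact: measurable_cst.
  - apply: emeasurable_funD; last exact/measurable_EFinP.
    apply: emeasurable_funD; last first.
      by apply: emeasurable_funM => //; exact/measurable_EFinP.
    apply: emeasurable_funD => //; apply: emeasurable_funM => //.
    exact/measurable_EFinP.
  - apply: filterS (density_gt0 hh) => x hx.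
    rewrite -!EFinM -!EFinD lee_fin.
    exact: Renyi_pointwise.
have i1 := integrableZl measurableT ((K - lam) / m) if_.
have i2 := integrableD measurableT i1 (ic (lam - 1 - (alpha - 1)^-1)%R).
have i3 := integrableZl measurableT ((alpha - 1)^-1 / a) iG1.
have i4 := integrableD measurableT i2 i3.
rewrite (integralD measurableT i4 iG2) (integralD measurableT i2 i3).
rewrite (integralD measurableT i1 (ic _)) (integralZl measurableT if_).
rewrite (integralZl measurableT iG1) pf integral_cst//= probability_setT mule1.
rewrite -/A Aa -!EFinM -!EFinD => /le_trans /(_ (leeD2l _ G2le)).
rewrite -EFinD lee_fin !divfK ?gt_eqF//.
lra.
Qed.

(** The change of measure for the constant function 1, for which both logarithms vanish. *)
Lemma Renyi_ge0 {d} {T : measurableType d} {R : realType} (p q : probability T R)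
  (alpha : R) : (1 < alpha)%R -> 0 <= Renyi alpha p q.
Proof.
move=> a1; have := @Renyi_change_of_measure _ _ _ p q alpha (alpha / (alpha - 1))
  1 1 1 (cst 1%R) a1.
rewrite /= ln1 !mulr0 adde0; apply => //.
- by move=> _; rewrite lexx ltr01.
- by rewrite integral_cst//= probability_setT mule1.
- by rewrite expR0 integral_cst//= probability_setT mule1.
Qed.

(** * Probabilities and kernels built from fibres, densities and restrictions *)

Section kernel_probability.
Context {dX dY} {X : measurableType dX} {Y : measurableType dY} {R : realType}.
Variables (k : R.-pker X ~> Y) (x : X).

Definition kernel_prob : set Y -> \bar R := k x.

HB.instance Definition _ := Measure.copy kernel_prob (k x).

HB.instance Definition _ := Measure_isProbability.Build _ _ _ kernel_prob
  (@prob_kernel _ _ _ _ _ k x).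

End kernel_probability.

Section density_probability.
Context {d} {T : measurableType d} {R : realType}.
Variables (P : probability T R) (r : T -> R).
Hypotheses (mr : measurable_fun setT r) (r0 : forall x, (0 <= r x)%R)
  (r1 : \int[P]_x (r x)%:E = 1).

(** The proofs are arguments because the measure and probability structures attached to this
    function depend on them. *)
Definition density_prob of measurable_fun setT r & (forall x, (0 <= r x)%R)
  & \int[P]_x (r x)%:E = 1 : set T -> \bar R := fun A => \int[P]_(x in A) (r x)%:E.

Local Notation nu := (density_prob mr r0 r1).

Let nu0 : nu set0 = 0. Proof. exact: integral_set0. Qed.

Let nu_ge0 A : 0 <= nu A.
Proof. by apply: integral_ge0 => x _; rewrite lee_fin. Qed.

Let nu_sigma_additive : semi_sigma_additive nu.
Proof.
move=> F mF tF mUF; rewrite /density_prob ge0_integral_bigcup//.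
- by apply: is_cvg_nneseries => n _ _; exact: nu_ge0.
- exact/measurable_funTS/measurable_EFinP.
- by move=> x _; rewrite lee_fin.
Qed.

HB.instance Definition _ := isMeasure.Build _ _ _ nu nu0 nu_ge0 nu_sigma_additive.

HB.instance Definition _ := Measure_isProbability.Build _ _ _ nu r1.

Lemma density_probP : is_density P nu r.
Proof. by split. Qed.

End density_probability.

Section restricted_kernel.
Context {dX dY} {X : measurableType dX} {Y : measurableType dY} {R : realType}.
Variables (k : R.-pker X ~> Y) (G : set (X * Y)).
Hypothesis mG : measurable G.

Definition restricted_kernel : X -> {measure set Y -> \bar R} :=
  fun x => mrestr (k x) (measurable_xsection x mG).

Let measurable_restricted_kernel U : measurable U ->
  measurable_fun setT (restricted_kernel ^~ U).
Proof.
move=> mU; rewrite (_ : (fun _ => _) =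
    (fun x => k x (xsection ((setT `*` U) `&` G) x))).
  by apply: measurable_kernel_xsection; apply: measurableI => //; exact: measurableX.
apply/funext => x; rewrite /restricted_kernel/= /mrestr xsectionI.
by rewrite in_xsectionX// inE.
Qed.

HB.instance Definition _ := isKernel.Build _ _ _ _ _
  restricted_kernel measurable_restricted_kernel.

End restricted_kernel.

(** * Conditioning a joint law on an event *)

Section conditioning.
Context {dX dY} {X : measurableType dX} {Y : measurableType dY} {R : realType}.
Variables (P : probability X R) (k : R.-pker X ~> Y) (G : set (X * Y)).
Variable c : R.
Hypotheses (mG : measurable G) (c0 : (0 < c)%R).
Hypothesis Gc : joint_prob P k G = c%:E.

Let a x := fine (k x (xsection G x)).

Let mGx x : measurable (xsection G x).
Proof. exact: measurable_xsection. Qed.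

Let kle1 x A : measurable A -> k x A <= 1.
Proof.
by move=> mA; rewrite -(@prob_kernel _ _ _ _ _ k x) le_measure// inE.
Qed.

Let aE x : k x (xsection G x) = (a x)%:E.
Proof.
by rewrite fineK// ge0_fin_numE// (le_lt_trans (kle1 x (mGx x)))// ltry.
Qed.

Let a_ge0 x : (0 <= a x)%R. Proof. by rewrite -lee_fin -aE. Qed.

Let a_le1 x : (a x <= 1)%R. Proof. by rewrite -lee_fin -aE kle1. Qed.

Let measurable_a : measurable_fun setT a.
Proof. by apply: measurableT_comp => //; exact: measurable_kernel_xsection. Qed.

Let r x := (a x / c)%R.

Let measurable_r : measurable_fun setT r.
Proof. exact: measurable_funM. Qed.

Let r_ge0 x : (0 <= r x)%R. Proof. by rewrite divr_ge0// ltW. Qed.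

Let r1 : \int[P]_x (r x)%:E = 1.
Proof.
under eq_integral do rewrite EFinM.
rewrite ge0_integralZr//; last 3 first.
- exact/measurable_EFinP.
- by move=> x _; rewrite lee_fin.
- by rewrite lee_fin invr_ge0 ltW.
rewrite (eq_integral (fun x => k x (xsection G x))) => [|x _]; last by rewrite aE.
by rewrite -[X in X * _]/(joint_prob P k G) Gc -EFinM mulfV// gt_eqF.
Qed.

(** With [a x] the mass of the section of [G] under [k x], the marginal is reweighted by [a / c] and
    each fibre is [k x] conditioned on its section. The factor [a] of the marginal cancels the
    [1 / a] of the fibre, which leaves the joint density [\1_G / c]. *)
Lemma conditioning : exists (nuS : probability X R) (nuY : R.-pker X ~> Y)
    (a : X -> R),
  [/\ measurable_fun setT a /\ (forall x, (0 <= a x <= 1)%R),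
     is_density P nuS (fun x => a x / c)%R,
     is_density (joint_prob P k) (joint_prob nuS nuY) (fun z => \1_G z / c)%R,
     is_density (joint_prob nuS k) (joint_prob nuS nuY) (fun z => \1_G z / a z.1)%R &
     {ae nuS, forall x, nuY x (xsection G x) = 1}].
Proof.
have [x0 _] : exists x : X, True by apply: (ae_prob_ex (P := P)); exact: aeW.
pose nuS : probability X R := density_prob measurable_r r_ge0 r1.
(* Where [a x = 0] the normalization falls back on the fixed probability [k x0]. The density [a / c]
   vanishes there, so [nuS] does not see this choice. *)
pose nuY : R.-pker X ~> Y := knormalize (restricted_kernel k mG) (kernel_prob k x0).
have nuYE x A : (0 < a x)%R -> nuY x A = k x (A `&` xsection G x) * ((a x)^-1)%:E.
  move=> ax; rewrite /nuY/= /knormalize/mnormalize/= /restricted_kernel/=.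
  rewrite /mrestr setTI.
  by rewrite aE orbF/= eqe gt_eqF.
have hr : is_density P nuS r by exact: density_probP.
have kAG0 x A : measurable A -> a x = 0%R -> k x (A `&` xsection G x) = 0.
  move=> mA ax; apply/eqP; rewrite eq_le measure_ge0 andbT.
  apply: (@le_trans _ _ (k x (xsection G x))); last by rewrite aE ax.
  by rewrite le_measure ?inE//; exact: measurableI.
have nuE A : measurable A ->
    joint_prob nuS nuY A = \int[P]_x (k x (xsection (A `&` G) x) * (c^-1)%:E).
  move=> mA; rewrite /joint_prob /jointm (ge0_integral_density hr)//; last first.
    exact: measurable_kernel_xsection.
  apply: eq_integral => x _; rewrite xsectionI.
  have := a_ge0 x; rewrite le_eqVlt => /orP[/eqP/esym ax|ax].
    rewrite kAG0//; last exact: measurable_xsection.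
    by rewrite /r ax mul0r mule0 mul0e.
  rewrite nuYE// -muleA -EFinM /r; congr (_ * _%:E).
  by rewrite mulrA mulVf ?gt_eqF// mul1r.
exists nuS, nuY, a; split => //.
- by split => // x; rewrite a_ge0 a_le1.
- split.
  + exact: measurable_funM.
  + by move=> z; rewrite divr_ge0// ltW.
  + move=> A mA; rewrite nuE// ge0_integralZr//; last 2 first.
    * by apply: measurable_kernel_xsection; exact: measurableI.
    * by rewrite lee_fin invr_ge0 ltW.
    under [RHS]eq_integral do rewrite EFinM.
    rewrite [RHS]ge0_integralZr//; last 2 first.
    * exact/measurable_funTS/measurable_EFinP.
    * by rewrite lee_fin invr_ge0 ltW.
    by rewrite integral_indic// setIC.
- have ma1 : measurable_fun setT (fun z : X * Y => \1_G z / a z.1)%R.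
    apply: measurable_funM => //; apply: measurable_invr_ge0 => //.
    exact: measurableT_comp.
  split => //.
  + by move=> z; rewrite divr_ge0.
  + move=> A mA; rewrite nuE// [RHS]integral_mkcond ge0_integral_joint; last 2 first.
    * exact/(measurable_restrictT _ mA)/measurable_funTS/measurable_EFinP.
    * by move=> z; rewrite patchE; case: ifP => // _; rewrite lee_fin divr_ge0.
    transitivity (\int[nuS]_x (k x (xsection (A `&` G) x) * ((a x)^-1)%:E)).
      rewrite (ge0_integral_density hr)//; last 2 first.
      * apply: emeasurable_funM.
          by apply: measurable_kernel_xsection; exact: measurableI.
        exact/measurable_EFinP/measurable_invr_ge0.
      * by move=> x; rewrite mule_ge0// lee_fin invr_ge0.
      apply: eq_integral => x _; rewrite xsectionI.
      have := a_ge0 x; rewrite le_eqVlt => /orP[/eqP/esym ax|ax].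
        rewrite kAG0//; last exact: measurable_xsection.
        by rewrite !mul0e.
      rewrite -muleA -EFinM /r; congr (_ * _%:E).
      by rewrite mulrA mulVf ?gt_eqF// mul1r.
    apply: eq_integral => x _.
    have mAGx : measurable (xsection (A `&` G) x).
      by apply: measurable_xsection; exact: measurableI.
    rewrite -[X in k x X]setIT -integral_indic// -ge0_integralZr//; last 2 first.
    * exact/measurable_EFinP.
    * by rewrite lee_fin invr_ge0.
    apply: eq_integral => y _; rewrite patchE !indicE mem_xsection in_setI.
    by case: ifP => _; rewrite ?mul0e//.
- apply: filterS (density_gt0 hr) => x rx.
  have ax : (0 < a x)%R by move: rx; rewrite /r pmulr_lgt0// invr_gt0.
  by rewrite nuYE// setIid aE -EFinM mulfV// gt_eqF.
Qed.

End conditioning.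

(** Almost surely the three log-densities are [- ln c], [- ln a] and [ln a - ln c], so the chain
    rule holds pointwise and everything reduces to [kl], the [nuS]-mean of [- ln a]. *)
Lemma conditioning_KL {dX dY} {X : measurableType dX} {Y : measurableType dY}
    {R : realType} (P : probability X R) (k : R.-pker X ~> Y)
    (G : set (X * Y)) (c : R) :
  measurable G -> (0 < c)%R -> joint_prob P k G = c%:E ->
  exists (nuS : probability X R) (nuY : R.-pker X ~> Y) (r : X -> R) (kl : R),
  [/\ [/\ is_density P nuS r, nuS.-integrable setT (fun x => (ln (r x))%:E) &
          \int[nuS]_x (ln (r x))%:E = (- ln c - kl)%:E],
     KL (joint_prob nuS nuY) (joint_prob P k) = (- ln c)%:E,
     KL (joint_prob nuS nuY) (joint_prob nuS k) = kl%:E,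
     {ae joint_prob nuS nuY, forall z, G z} &
     {ae nuS, forall x, nuY x (xsection G x) = 1}].
Proof.
move=> mG c0 Gc.
have [nuS [nuY [a [[ma a01] hr h1 h2 nuY1]]]] := conditioning mG c0 Gc.
have nuG : {ae joint_prob nuS nuY, forall z, G z}.
  apply: filterS (density_gt0 h1) => z; rewrite indicE.
  by have [/set_mem//|_] := boolP (z \in G); rewrite mul0r ltxx.
have agt0 : {ae nuS, forall x, (0 < a x)%R}.
  by apply: filterS (density_gt0 hr) => x; rewrite pmulr_lgt0// invr_gt0.
have a0 x : (0 <= a x)%R by case/andP: (a01 x).
have a1 x : (a x <= 1)%R by case/andP: (a01 x).
have mlna : measurable_fun setT (fun x => - (ln (a x)))%R.
  by apply: measurableT_comp => //; exact: measurableT_comp.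
have lna0 x : (0 <= - ln (a x))%R by rewrite oppr_ge0 ln_le0.
(* Under P the integrand becomes [- ln a * a / c], bounded by [1 / c] because
   [ln (1/a) <= 1/a - 1]. *)
have ilna : nuS.-integrable setT (fun x => (- ln (a x))%:E).
  apply/integrableP; split; first exact/measurable_EFinP.
  under eq_integral do rewrite gee0_abs ?lee_fin//.
  rewrite (ge0_integral_density hr)//; last exact/measurable_EFinP.
  apply: (@le_lt_trans _ _ (\int[P]_x (c^-1)%:E)); last first.
    by rewrite integral_cst//= probability_setT mule1 ltry.
  apply: ge0_le_integral => //.
  - by move=> x _; rewrite mule_ge0// lee_fin// divr_ge0// ltW.
  - by apply: emeasurable_funM; apply/measurable_EFinP => //; exact: measurable_funM.
  - move=> x _; rewrite -EFinM lee_fin mulrA ler_piMl ?invr_ge0 ?(ltW c0)//.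
    have := a0 x; rewrite le_eqVlt => /orP[/eqP <-|ax]; first by rewrite mulr0 ler01.
    have := ln_le_subr1 (x := (a x)^-1); rewrite invr_gt0 => /(_ ax).
    rewrite lnV ?posrE// => /(ler_wpM2r (ltW ax)) /le_trans; apply.
    by rewrite mulrBl mulVf ?gt_eqF// mul1r lerBlDr lerDl.
exists nuS, nuY, (fun x => a x / c)%R, (fine (\int[nuS]_x (- ln (a x))%:E)).
have fin := integrable_fin_num measurableT ilna.
have ic (s : R) : nuS.-integrable setT (cst s%:E).
  exact: finite_measure_integrable_cst.
have mlnr : measurable_fun setT (fun x => (ln (a x / c))%:E).
  by apply/measurable_EFinP; apply: measurableT_comp => //; exact: measurable_funM.
have ilnr : nuS.-integrable setT (fun x => (- ln c)%:E - (- ln (a x))%:E).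
  exact: (integrableB measurableT (ic (- ln c)%R) ilna).
have lnrE : ae_eq nuS setT (fun x => (- ln c)%:E - (- ln (a x))%:E)
    (fun x => (ln (a x / c))%:E).
  apply: filterS agt0 => x ax _; rewrite -EFinB ln_div//; congr (_%:E); lra.
split => //.
- split => //.
  + by apply: ae_le_integrable ilnr _ => //; apply: filterS lnrE => x /(_ I) ->.
  + rewrite -(ae_eq_integral _ _ measurableT (measurable_int _ ilnr) mlnr lnrE).
    rewrite (integralB measurableT (ic (- ln c)%R) ilna).
    rewrite integral_cst//= probability_setT mule1.
    by rewrite -[X in _ - X = _](fineK fin).
- rewrite (KL_density h1) (ae_eq_integral (cst (- ln c)%:E))//.
  + by rewrite integral_cst//= probability_setT mule1.
  + apply/measurable_EFinP; apply: measurableT_comp => //.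
    exact: measurable_funM.
  + apply: filterS nuG => z /mem_set zG _; rewrite indicE zG mul1r lnV ?posrE//.
- rewrite (KL_density h2) fineK// -(integral_joint_fst nuS nuY); last first.
    exact/measurable_EFinP.
  apply: ae_eq_integral => //.
  + apply/measurable_EFinP; apply: measurableT_comp => //.
    apply: measurable_funM => //; apply: measurable_invr_ge0 => //.
    exact: measurableT_comp.
  + by apply/measurable_EFinP; apply: (measurableT_comp mlna).
  + apply: filterS2 nuG (density_gt0 h2) => z /mem_set zG.
    rewrite indicE zG mul1r => az _.
    by rewrite lnV// posrE -invr_gt0.
Qed.

(** * Lower bounds for the functional T *)

(** Real lower bounds exclude -oo, and +oo absorbs, so infinite values never spoil the sum. *)
Lemma dual_adde_ge {R : realType} (a b : R) (x y : \bar R) :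
  a%:E <= x -> b%:E <= y -> (a + b)%:E <= dual_adde x y.
Proof.
move: x y => [x| |] [y| |]; rewrite ?leeNy_eq ?lee_fin//=; last 3 first.
- by move=> *; exact: leey.
- by move=> *; exact: leey.
- by move=> *; exact: leey.
by move=> *; exact: lerD.
Qed.

(** When [g] is integrable, Donsker-Varadhan bounds the functional below by [lam * E[g] - l], and
    the constraint gives [E[g] >= D - eps]. In general [B / lam] replaces [g]. *)
Lemma frakT1_ge {dX dY dZ} {X : measurableType dX} {Y : measurableType dY}
    {Z : measurableType dZ} {R : realType} (P nuS : probability X R)
    (nuY : R.-pker X ~> Y) (p q : R.-pker X ~> Z) (r : X -> R)
    (Delta : X * Y -> R) (g : X * Z -> R) (lam eps l D : R) :
  is_density P nuS r -> nuS.-integrable setT (fun x => (ln (r x))%:E) ->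
  \int[nuS]_x (ln (r x))%:E = l%:E ->
  (joint_prob nuS nuY).-integrable setT (EFin \o Delta) ->
  \int[joint_prob nuS nuY]_z (Delta z)%:E = D%:E ->
  measurable_fun setT g -> (0 < lam)%R ->
  \int[joint_prob (joint_prob nuS nuY) (kernel_fst p)]_y
    (Delta y.1 - g (y.1.1, y.2))%:E <= eps%:E ->
  (lam * (D - eps) - l)%:E <=
    frakT 1 P nuS (fun s => p s) (fun s => q s) (fun z => lam * g z)%R.
Proof.
move=> hr ilnr lE iD DE mg lam0 hQ.
rewrite /frakT eqxx -!/(joint_prob _ _).
have mlg : measurable_fun setT (fun z => lam * g z)%R by exact: measurable_funM.
set E := \int[_]_z _.
have E0 : 0 < E.
  apply: integral_gt0_prob => [|z]; last by rewrite lte_fin expR_gt0.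
  exact/measurable_EFinP/measurableT_comp.
have [KLoo|] := eqVneq (KL (joint_prob nuS p) (joint_prob nuS q)) +oo.
  by rewrite KLoo leey.
move=> /[dup] KLoo /KL_integrable[h [hh ilnh]].
have [->|] := eqVneq E +oo.
  by rewrite /= /dual_adde; case: KL => *; exact: leey.
rewrite -ltey => Eoo.
have [C EC] : exists C, E = C%:E.
  by exists (fine E); rewrite fineK// ge0_fin_numE// ltW.
have C0 : (0 < C)%R by rewrite -lte_fin -EC.
rewrite EC lne_EFin//.
pose Q := joint_prob nuS p.
have [mr r0 _] := hr; have [mh h0 _] := hh.
(* The density of p nu_S with respect to q P_S is [h] times [r]; its logarithm splits the divergence
   into the [KL] term plus [l]. *)
have hu := density_trans (joint_density_fst q hr) hh.
have ilnr1 : Q.-integrable setT (fun z => (ln (r z.1))%:E).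
  apply: (integrable_mpres (mu2 := nuS) (phi := fst)) ilnr => //.
  by move=> A mA; exact/esym/joint_prob_fst.
have lnuE : {ae Q, forall z, ln (h z * r z.1) = (ln (h z) + ln (r z.1))%R}.
  apply: filterS2 (density_gt0 hh) (density_gt0 hu) => z hz huz.
  by rewrite lnM// posrE; move: huz; rewrite pmulr_rgt0.
have ilnhr := integrableD measurableT ilnh ilnr1.
have mlnu : measurable_fun setT (fun z => (ln (h z * r z.1))%:E).
  apply/measurable_EFinP; apply: measurableT_comp => //.
  apply: measurable_funM => //; exact: measurableT_comp.
have ilnu : Q.-integrable setT (fun z => (ln (h z * r z.1))%:E).
  by apply: ae_le_integrable ilnhr _ => //; apply: filterS lnuE => z ->.
have lnuI : \int[Q]_z (ln (h z * r z.1))%:E = KL Q (joint_prob nuS q) + l%:E.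
  rewrite (KL_density hh) -lE -(integral_joint_fst nuS p); last first.
    exact: measurable_int ilnr.
  rewrite -(integralD measurableT ilnh ilnr1).
  apply: ae_eq_integral => //; first exact: measurable_int ilnhr.
  by apply: filterS lnuE => z -> _.
have [B [iB Ble lgB]] := donsker_varadhan hu ilnu mlg EC.
pose phi (y : X * Y * Z) := (y.1.1, y.2).
pose Q3 := joint_prob (joint_prob nuS nuY) (kernel_fst p).
have mphi : measurable_fun setT phi.
  apply: measurable_fun_pair => //; exact: measurableT_comp.
have phiE A : measurable A -> Q A = Q3 (phi @^-1` A) by exact: joint_prob_marginal.
have iD3 : Q3.-integrable setT (fun y => (Delta y.1)%:E).
  apply: (integrable_mpres (mu2 := joint_prob nuS nuY) (phi := fst)) iD => //.
  by move=> A mA; exact/esym/joint_prob_fst.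
have D3E : \int[Q3]_y (Delta y.1)%:E = D%:E.
  by rewrite -DE -(integral_joint_fst _ (kernel_fst p))//; exact: measurable_int iD.
(* [Delta - g] need not be integrable, and its integral is [-oo] when both its
   parts are infinite, but its lower bound [Delta - B / lam] is integrable. *)
have iB3 : Q3.-integrable setT (EFin \o B \o phi).
  exact: (integrable_mpres (mu2 := Q)) iB.
have mB := measurable_int _ iB.
have B3E : \int[Q3]_y (B (phi y))%:E = \int[Q]_z (B z)%:E.
  by rewrite (integral_mpres mphi phiE).
have mDl : measurable_fun setT (fun y : X * Y * Z => (Delta y.1 - g (phi y))%:E).
  apply/measurable_EFinP; apply: measurable_funB; last exact: measurableT_comp.
  apply: (measurableT_comp (f := Delta)) => //.
  by apply/measurable_EFinP; exact: measurable_int iD.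
have i1 := integrableZl measurableT lam^-1%R iB3.
have i2 := integrableB measurableT iD3 i1.
have := le_trans (ae_le_integral (measurable_int _ i2) mDl _) hQ.
rewrite (integralB measurableT iD3 i1) (integralZl measurableT iB3) D3E B3E.
have fB := integrable_fin_num measurableT iB.
have fK : KL Q (joint_prob nuS q) \is a fin_num.
  by rewrite (KL_density hh); exact: integrable_fin_num.
move: Ble; rewrite lnuI -(fineK fB) -(fineK fK) -EFinM -EFinB -!EFinD !lee_fin.
set b := fine _; set kk := fine _ => Ble h3.
have {}h3 : (D - lam^-1 * b <= eps)%R.
  apply: h3; apply: filterS (ae_mpres mphi phiE lgB) => y.
  move=> yB; rewrite [(_ \o _) y]/= -EFinM -EFinB lee_fin lerB//.
  by rewrite ler_pdivlMl.
have := ler_wpM2l (ltW lam0) h3.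
rewrite mulrBr mulrA mulfV ?gt_eqF// mul1r; lra.
Qed.

(** In each fibre the Renyi divergence is at least [lam * ln (m x) - ln (b x)], where [b x] is the
    q-mean of the truncated [f] to the power [lam]. Donsker-Varadhan on X puts [ln b] below an
    integrable function whose [nuS]-mean is at most [ln C' + l]. *)
Lemma frakT_ge {dX dY} {X : measurableType dX} {Y : measurableType dY}
    {R : realType} (P nuS : probability X R)
    (nuY q : R.-pker X ~> Y) (r m : X -> R)
    (f : X * Y -> R) (alpha lam l L M : R) :
  is_density P nuS r -> nuS.-integrable setT (fun x => (ln (r x))%:E) ->
  \int[nuS]_x (ln (r x))%:E = l%:E ->
  measurable_fun setT f -> (forall z, (0 < f z)%R) -> (0 < M)%R ->
  (forall x, \int[nuY x]_y (Num.min (f (x, y)) M)%:E = (m x)%:E) ->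
  nuS.-integrable setT (fun x => (ln (m x))%:E) ->
  \int[nuS]_x (ln (m x))%:E = L%:E ->
  (1 < alpha)%R -> (alpha / (alpha - 1) <= lam)%R ->
  (lam * L - l)%:E <= frakT alpha P nuS (fun s => nuY s) (fun s => q s)
                        (fun z => lam * ln (f z))%R.
Proof.
move=> hr ilnr lE mf f0 M0 mE ilnm LE a1 al.
have lam0 : (0 < lam)%R.
  apply: lt_le_trans al; apply: divr_gt0; lra.
(* Truncation makes every fibre moment under q finite and can only lower the global moment, so a
   bound involving [C'] implies the one involving [C]. *)
pose f' z := Num.min (f z) M.
have mf' : measurable_fun setT f' by exact: measurable_minr.
have f'0 z : (0 < f' z)%R by rewrite lt_min f0.
have f'f z : (f' z <= f z)%R by rewrite ge_min lexx.
have f'M z : (f' z <= M)%R by rewrite ge_min lexx orbT.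
rewrite /frakT gt_eqF// -/(joint_prob _ _).
have mexp (h : X * Y -> R) : measurable_fun setT h ->
    measurable_fun setT (fun z => (expR (lam * ln (h z)))%:E).
  move=> mh; apply/measurable_EFinP; apply: measurableT_comp => //.
  by apply: measurable_funM => //; exact: measurableT_comp.
have exple z : (expR (lam * ln (f' z)) <= expR (lam * ln M))%R.
  by rewrite ler_expR ler_pM2l// ler_ln// posrE.
set E := \int[joint_prob P q]_z _.
have E0 : 0 < E.
  by apply: integral_gt0_prob => [|z]; [exact: mexp|rewrite lte_fin expR_gt0].
have [->|] := eqVneq E +oo.
  by rewrite /= /dual_adde; case: integral => *; exact: leey.
rewrite -ltey => Eoo.
have [C EC] : exists C, E = C%:E.
  by exists (fine E); rewrite fineK// ge0_fin_numE// ltW.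
have C0 : (0 < C)%R by rewrite -lte_fin -EC.
rewrite EC lne_EFin//.
pose E' := \int[joint_prob P q]_z (expR (lam * ln (f' z)))%:E.
have E'E : E' <= E.
  apply: ge0_le_integral => //.
  - exact: mexp.
  - exact: mexp.
  - by move=> z _; rewrite lee_fin ler_expR ler_pM2l// ler_ln ?posrE.
have E'0 : 0 < E'.
  by apply: integral_gt0_prob => [|z]; [exact: mexp|rewrite lte_fin expR_gt0].
have [C' E'C] : exists C, E' = C%:E.
  by exists (fine E'); rewrite fineK// ge0_fin_numE ?ltW// (le_lt_trans E'E).
have C'0 : (0 < C')%R by rewrite -lte_fin -E'C.
have C'C : (ln C' <= ln C)%R by rewrite ler_ln// -lee_fin -EC -E'C.
pose b x := fine (\int[q x]_y (expR (lam * ln (f' (x, y))))%:E).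
have mexp1 x : measurable_fun setT (fun y => (expR (lam * ln (f' (x, y))))%:E).
  by apply: (measurableT_comp (mexp _ mf')); exact: pair1_measurable.
have bE x : \int[q x]_y (expR (lam * ln (f' (x, y))))%:E = (b x)%:E.
  rewrite fineK// ge0_fin_numE ?integral_ge0//.
  apply: (@le_lt_trans _ _ (\int[q x]_y (expR (lam * ln M))%:E)).
    by apply: ge0_le_integral => // y _; rewrite lee_fin.
  by rewrite integral_cst//= prob_kernel mule1 ltry.
have b0 x : (0 < b x)%R.
  rewrite -lte_fin -bE -[X in integral X]/(kernel_prob q x : set _ -> _).
  by apply: integral_gt0_prob => // y; rewrite lte_fin expR_gt0.
have mb : measurable_fun setT b.
  apply: measurableT_comp => //.
  apply: (measurable_fun_integral_finite_kernel
    (fun z => (expR (lam * ln (f' z)))%:E)) => //; last exact: mexp.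
have mlnb : measurable_fun setT (fun x => ln (b x)) by exact: measurableT_comp.
have bC' : \int[P]_x (expR (ln (b x)))%:E = C'%:E.
  rewrite -E'C /E' ge0_integral_joint//; last exact: mexp.
  by apply: eq_integral => x _; rewrite bE lnK ?posrE.
have [B [iB Ble [N [mN N0 bB]]]] := donsker_varadhan hr ilnr mlnb bC'.
have mB := measurable_int _ iB.
have i1 := integrableZl measurableT lam ilnm.
have i2 := integrableB measurableT i1 iB.
have mi2 := measurable_int _ i2.
have RE x : (lam * ln (m x))%:E <= Renyi alpha (nuY x) (q x) + (ln (b x))%:E.
  apply: (Renyi_change_of_measure (p := kernel_prob nuY x)
    (q := kernel_prob q x) (f := fun y => f' (x, y)) (M := M)) => //.
  - by apply: (measurableT_comp mf'); exact: pair1_measurable.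
  - by move=> y; rewrite f'0 f'M.
  - exact: mE.
  - exact: bE.
(* The comparison with the possibly non-measurable Renyi integrand must hold at every point and
   between nonnegative functions. Hence the positive part, and the value 0 on the null set [N] where
   [B] may fail to dominate [ln b]. *)
pose J x := maxe 0 ((lam%:E * (ln (m x))%:E) - (B x)%:E).
have JR : \int[nuS]_x (J \_ (~` N)) x <= \int[nuS]_x Renyi alpha (nuY x) (q x).
  apply: ge0_le_integral_nonmeas => x.
    by rewrite patchE; case: ifP => // _; rewrite le_max lexx.
  have R0 : 0 <= Renyi alpha (nuY x) (q x).
    exact: (Renyi_ge0 (kernel_prob nuY x) (kernel_prob q x)).
  rewrite patchE; case: ifPn => // /set_mem Nx.
  rewrite /J ge_max R0 andTb leeBlDr//.
  rewrite -EFinM (le_trans (RE x))// leeD2l// lee_fin.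
  by apply: contrapT => xB; apply: Nx; apply: bB.
have : \int[nuS]_x (lam%:E * (ln (m x))%:E - (B x)%:E) <=
    \int[nuS]_x Renyi alpha (nuY x) (q x).
  apply: le_trans JR; apply: ae_le_integral => //.
  - apply/(measurable_restrictT _ (measurableC mN))/measurable_funTS.
    exact: measurable_maxe.
  - exists N; split => // x /= Jx; apply: contrapT => Nx; apply: Jx.
    by rewrite patchE mem_set// /J le_max lexx orbT.
rewrite (integralB measurableT i1 iB) (integralZl measurableT ilnm) LE.
have fB := integrable_fin_num measurableT iB.
move: Ble; rewrite lE -(fineK fB) -EFinM -EFinB -EFinD lee_fin => Ble.
move=> /dual_adde_ge /(_ (lexx (ln C)%:E)); apply: le_trans.
rewrite lee_fin; lra.
Qed.

(** * Choice of the bad event and final contradiction *)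

(** As [Delta >= 0], [f] is positive wherever it exceeds [Delta], so the windows from [1 / (n + 1)]
    to [n + 1] exhaust that event, and continuity from below leaves more than [delta] in one of
    them. *)
Lemma joint_prob_superlevel_ex {dX dY} {X : measurableType dX}
    {Y : measurableType dY} {R : realType} (P : probability X R)
    (k : R.-pker X ~> Y) (f Delta : X * Y -> R) (delta : R) :
  measurable_fun setT f -> measurable_fun setT Delta ->
  (forall z, (0 <= Delta z)%R) ->
  joint_prob P k [set z | (f z <= Delta z)%R] < (1 - delta)%:E ->
  exists M c : R, let G := [set z | (Delta z < f z)%R && (M^-1 <= f z <= M)%R] in
  [/\ (1 <= M)%R, (delta < c)%R, measurable G & joint_prob P k G = c%:E].
Proof.
move=> mf mDelta Delta0 lt.
pose G n := [set z | (Delta z < f z)%R && (n.+1%:R^-1 <= f z <= n.+1%:R)%R].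
have mG n : measurable (G n).
  apply: measurable_bool_set; apply: measurable_and.
    exact: measurable_fun_ltr.
  by apply: measurable_and; exact: measurable_fun_ler.
have Gcup : \bigcup_n G n = ~` [set z | (f z <= Delta z)%R].
  apply/seteqP; split => z /=.
    by move=> [n _] /= /andP[+ _]; rewrite ltNge => /negP.
  move=> /negP; rewrite -ltNge => Df.
  have f0 : (0 < f z)%R by rewrite (le_lt_trans (Delta0 z)).
  pose n := Num.truncn (Num.max (f z) (f z)^-1)%R.
  have : (Num.max (f z) (f z)^-1 < n.+1%:R)%R by exact: truncnS_gt.
  rewrite gt_max => /andP[n1 n2]; exists n => //=.
  by rewrite /G/= Df (ltW n1) andbT -[leRHS]invrK lef_pV2 ?posrE ?invr_gt0// ltW.
have mfD : measurable [set z | (f z <= Delta z)%R].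
  by apply: measurable_bool_set; exact: measurable_fun_ler.
have cvgG : (joint_prob P k (G n)) @[n --> \oo] --> joint_prob P k (\bigcup_n G n).
  apply: nondecreasing_cvg_mu => //; first exact: bigcupT_measurable.
  move=> m n mn; apply/subsetPset => z; rewrite /G/= => /and3P[-> h1 h2]/=.
  rewrite (le_trans _ h1)/= ?(le_trans h2) ?ler_nat//.
  by rewrite lef_pV2 ?posrE// ler_nat.
have [n Gn] : exists n, delta%:E < joint_prob P k (G n).
  apply: contrapT => /forallNP Gle; move: lt; apply/negP; rewrite -leNgt.
  have : joint_prob P k (~` [set z | (f z <= Delta z)%R]) <= delta%:E.
    rewrite -Gcup -(cvg_lim _ cvgG)//; apply: lime_le.
      by apply/cvg_ex; exists (joint_prob P k (\bigcup_n G n)).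
    by apply: nearW => n; rewrite leNgt; exact/negP/Gle.
  rewrite probability_setC// leeBlDr; last exact: fin_num_measure.
  by rewrite EFinB leeBlDr// addeC.
exists n.+1%:R, (fine (joint_prob P k (G n))) => /=.
have Gfin : joint_prob P k (G n) \is a fin_num by exact: fin_num_measure.
split; rewrite ?ler1n ?fineK//; first by rewrite -lte_fin fineK.
exact: mG.
Qed.

(* S = Z^n (n-tuples), P_S = mu^{(x) n}; algorithm P_{W|S} a probability
   kernel; nu_{S,W} is given through its S-marginal nuS and conditional nuWS. *)
Theorem theorem3 (R : realType) (dZ dW dH : measure_display)
  (Z : measurableType dZ) (W : measurableType dW) (What : measurableType dH)
  (n : nat) (mu : probability Z R) (PS : probability (n.-tuple Z) R)
  (hPS : iid_product mu PS)
  (PWS : R.-pker (n.-tuple Z) ~> W)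
  (f Delta : n.-tuple Z * W -> R) (g : n.-tuple Z * What -> R)
  (hf : measurable_fun setT f) (hDelta : measurable_fun setT Delta)
  (hg : measurable_fun setT g)
  (hDelta0 : forall x, (0 <= Delta x)%R)
  (delta : R) (hdelta : (0 < delta)%R) :
  let inF (nuS : probability (n.-tuple Z) R) (nuWS : R.-pker (n.-tuple Z) ~> W) :=
    KL (jointm nuS (fun s => nuWS s)) (jointm PS (fun s => PWS s))
      <= (ln (delta^-1))%:E /\
    supp_pos (jointm nuS (fun s => nuWS s)) (fun x => (f x - Delta x)%R) in
  (* condition (i) *)
  ((exists eps : R,
     forall (nuS : probability (n.-tuple Z) R) (nuWS : R.-pker (n.-tuple Z) ~> W),
       inF nuS nuWS ->
       ereal_inf [set v | exists (p : R.-pker (n.-tuple Z) ~> What),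
         \int[jointm (jointm nuS (fun s => nuWS s)) (fun x => p x.1)]_y
             ((Delta y.1 - g (y.1.1, y.2))%R)%:E <= eps%:E /\
         exists (lam : R) (q : R.-pker (n.-tuple Z) ~> What), (0 < lam)%R /\
         v = dual_adde
               (dual_adde
                  (frakT 1 PS nuS (fun s => p s) (fun s => q s)
                     (fun z => (lam * g z)%R))
                  (- KL (jointm nuS (fun s => nuWS s))
                        (jointm nuS (fun s => PWS s))))
               (- (lam%:E * (\int[jointm nuS (fun s => nuWS s)]_x (Delta x)%:E
                              - eps%:E)))]
       <= (ln delta)%:E)
   \/
  (* condition (ii) *)
   ((forall x, (0 < f x)%R) /\
    exists alpha : R, (1 < alpha)%R /\
     forall (nuS : probability (n.-tuple Z) R) (nuWS : R.-pker (n.-tuple Z) ~> W),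
       inF nuS nuWS ->
       ereal_inf [set v | exists (q : R.-pker (n.-tuple Z) ~> W) (lam : R),
         (alpha / (alpha - 1) <= lam)%R /\
         v = dual_adde
               (dual_adde
                  (frakT alpha PS nuS (fun s => nuWS s) (fun s => q s)
                     (fun z => (lam * ln (f z))%R))
                  (- KL (jointm nuS (fun s => nuWS s))
                        (jointm nuS (fun s => PWS s))))
               (- (lam%:E * \int[nuS]_s
                              lne (\int[nuWS s]_w (Delta (s, w))%:E)))]
       <= (ln delta)%:E)) ->
  (1 - delta)%:E <= jointm PS (fun s => PWS s) [set x | (f x <= Delta x)%R].
Proof.
move=> inF H; rewrite leNgt; apply/negP => lt.
have [M [c [M1 dc mG Gc]]] := joint_prob_superlevel_ex hf hDelta hDelta0 lt.
move: mG Gc; set G := [set z | _] => mG Gc.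
have c0 : (0 < c)%R := lt_trans hdelta dc.
have M0 : (0 < M)%R := lt_le_trans ltr01 M1.
have [nuS [nuW [r [kl [[hr ilnr lE] K1 K2 nuG nuW1]]]]] := conditioning_KL mG c0 Gc.
have nuF : inF nuS nuW.
  split.
    suff : KL (joint_prob nuS nuW) (joint_prob PS PWS) <= (ln delta^-1)%:E by [].
    by rewrite K1 lee_fin lnV ?posrE// lerN2 ler_ln ?posrE// ltW.
  have [N [mN N0 GN]] := nuG.
  apply: (subset_measure0 (mu := joint_prob nuS nuW) _ mN) N0.
    apply: measurable_bool_set; apply: measurable_fun_ler => //.
    exact: measurable_funB.
  by move=> z /=; rewrite subr_le0 leNgt => /negP fD; apply: GN => /= /andP[].
have Kge : (- kl)%:E <= - KL (joint_prob nuS nuW) (joint_prob nuS PWS) by rewrite K2.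
suff : (ln c)%:E <= (ln delta)%:E by rewrite lee_fin ler_ln ?posrE// leNgt dc.
case: H => [[eps H]|[f0 [alpha [a1 H]]]].
- apply: le_trans (H nuS nuW nuF).
  apply: le_ereal_inf_tmp => _ [p [hQ [lam [q [lam0 ->]]]]].
  have iM : (joint_prob nuS nuW).-integrable setT (cst M%:E).
    exact: finite_measure_integrable_cst.
  have iD : (joint_prob nuS nuW).-integrable setT (EFin \o Delta).
    apply: ae_le_integrable iM _.
      exact/measurable_EFinP.
    apply: filterS nuG => z /= /and3P[Df _ fM].
    rewrite lee_fin !ger0_norm//; last exact: ltW.
    by rewrite (le_trans (ltW Df)).
  have [D DE] : exists D, \int[joint_prob nuS nuW]_z (Delta z)%:E = D%:E.
    exists (fine (\int[joint_prob nuS nuW]_z (Delta z)%:E)).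
    by rewrite fineK//; exact: integrable_fin_num iD.
  have T1 := frakT1_ge q hr ilnr lE iD DE hg lam0 hQ.
  have X1 : (- (lam * (D - eps)))%:E <=
      - (lam%:E * (\int[joint_prob nuS nuW]_x (Delta x)%:E - eps%:E)).
    by rewrite DE -EFinB -EFinM.
  (* The terms in [lam] cancel, and [l = - ln c - kl] turns [- l - kl] into [ln c]. *)
  apply: le_trans (dual_adde_ge (dual_adde_ge T1 Kge) X1).
  by rewrite lee_fin; lra.
- apply: le_trans (H nuS nuW nuF); apply: le_ereal_inf_tmp => _ [q [lam [al ->]]].
  have lam0 : (0 < lam)%R by apply: lt_le_trans al; apply: divr_gt0; lra.
  (* Truncation at [M] changes nothing on [G] and makes the fibre means finite for every [s],
     including exceptional ones. *)
  pose m s := fine (\int[nuW s]_w (Num.min (f (s, w)) M)%:E).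
  have mmin : measurable_fun setT (fun z => (Num.min (f z) M)%:E).
    by apply/measurable_EFinP; exact: measurable_minr.
  have mmin1 s : measurable_fun setT (fun w => (Num.min (f (s, w)) M)%:E).
    by apply: (measurableT_comp mmin); exact: pair1_measurable.
  have mE s : \int[nuW s]_w (Num.min (f (s, w)) M)%:E = (m s)%:E.
    rewrite fineK// ge0_fin_numE; last first.
      by apply: integral_ge0 => w _; rewrite lee_fin le_min !ltW.
    apply: (@le_lt_trans _ _ (\int[nuW s]_w M%:E)).
      apply: ge0_le_integral => // w _; last by rewrite lee_fin ge_min lexx orbT.
      by rewrite lee_fin le_min !ltW.
    by rewrite integral_cst//= prob_kernel mule1 ltry.
  have mm : measurable_fun setT m.
    apply: measurableT_comp => //.
    apply: (measurable_fun_integral_finite_kernel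
      (fun z => (Num.min (f z) M)%:E)) => //.
    by move=> z; rewrite lee_fin le_min !ltW.
  have mlnm : measurable_fun setT (fun s => (ln (m s))%:E).
    by apply/measurable_EFinP; exact: measurableT_comp.
  have mGs s : measurable (xsection G s) by exact: measurable_xsection.
  have aeG s : nuW s (xsection G s) = 1 -> {ae nuW s, forall w, G (s, w)}.
    move=> Gs1; exists (~` xsection G s); split.
    - exact: measurableC.
    - rewrite -[LHS]/(kernel_prob nuW s (~` xsection G s)) probability_setC//.
      by rewrite [X in _ - X]Gs1 subee.
    - by move=> w /=; rewrite /xsection/= inE.
  (* On [G] the truncated [f] stays above [M^-1] because [1 <= M]. These two bounds give
     [|ln (m s)| <= ln M], hence integrability of [ln m]. *)
  have Mm s : nuW s (xsection G s) = 1 -> (M^-1 <= m s <= M)%R.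
    move=> /aeG aeGs; rewrite -!lee_fin -mE; apply/andP; split.
      rewrite -[leLHS]mule1 -(@prob_kernel _ _ _ _ _ nuW s) -integral_cst//.
      apply: ae_ge0_le_integral => //.
      + by move=> w _; rewrite lee_fin invr_ge0 ltW.
      + by move=> w _; rewrite lee_fin le_min !ltW.
      + apply: filterS aeGs => w /= /and3P[_ fM _] _; rewrite lee_fin le_min fM/=.
        by rewrite (le_trans _ M1)// invf_le1.
    rewrite -[leRHS]mule1 -(@prob_kernel _ _ _ _ _ nuW s) -integral_cst//.
    apply: ge0_le_integral => // w _; last by rewrite lee_fin ge_min lexx orbT.
    by rewrite lee_fin le_min !ltW.
  have ilnM : nuS.-integrable setT (cst (ln M)%:E).
    exact: finite_measure_integrable_cst.
  have ilnm : nuS.-integrable setT (fun s => (ln (m s))%:E).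
    apply: ae_le_integrable ilnM _ => //.
    apply: filterS nuW1 => s /Mm/andP[h1 h2] /=.
    have ms0 : (0 < m s)%R by rewrite (lt_le_trans _ h1)// invr_gt0.
    rewrite lee_fin [leRHS]ger0_norm ?ln_ge0// ler_norml -lnV ?posrE//.
    by rewrite !ler_ln ?posrE ?invr_gt0// h1.
  have [L LE] : exists L, \int[nuS]_s (ln (m s))%:E = L%:E.
    exists (fine (\int[nuS]_s (ln (m s))%:E)).
    by rewrite fineK//; exact: integrable_fin_num ilnm.
  have T1 := frakT_ge q hr ilnr lE hf f0 M0 mE ilnm LE a1 al.
  (* On [G] one has [Delta < f <= M], so fibre means of [Delta] are at most [m]. A zero mean gives
     [lne] the value -oo, which is harmless for an upper bound. *)
  have XL : \int[nuS]_s lne (\int[nuW s]_w (Delta (s, w))%:E) <= L%:E.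
    rewrite -LE; apply: ae_le_integral => //.
      apply: measurableT_comp; first exact: measurable_lne.
      apply: (measurable_fun_integral_finite_kernel (fun z => (Delta z)%:E)) => //.
      exact/measurable_EFinP.
    apply: filterS nuW1 => s /[dup] /aeG aeGs /Mm/andP[h1 _].
    have ms0 : (0 < m s)%R by rewrite (lt_le_trans _ h1)// invr_gt0.
    have Delta_ge0 : 0 <= \int[nuW s]_w (Delta (s, w))%:E.
      by apply: integral_ge0 => w _; rewrite lee_fin.
    rewrite -lne_EFin// lee_lne ?in_itv/= ?leey ?andbT ?lee_fin ?(ltW ms0)//.
    rewrite -mE; apply: ae_ge0_le_integral => //.
    + by move=> w _; rewrite lee_fin.
    + apply: (measurableT_comp (f := EFin \o Delta)); last exact: pair1_measurable.
      exact/measurable_EFinP.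
    + by move=> w _; rewrite lee_fin le_min !ltW.
    + apply: filterS aeGs => w /= /and3P[Df _ fM] _.
      by rewrite lee_fin le_min !ltW// (lt_le_trans Df).
  have X1 : (- (lam * L))%:E <=
      - (lam%:E * \int[nuS]_s lne (\int[nuW s]_w (Delta (s, w))%:E)).
    by rewrite EFinN EFinM leeN2 lee_wpmul2l// lee_fin ltW.
  apply: le_trans (dual_adde_ge (dual_adde_ge T1 Kge) X1).
  by rewrite lee_fin; lra.
Qed.
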